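(* Let $(X_n)$ be a sequence of finite, connected, vertex transitive graphs with $|X_n|\to\infty$ and $$|X_n| = o\!\left(\operatorname{diam}(X_n)^{\,2-\frac{1}{\log_3 4}}\right).$$ Then the scaling limit of $(X_n)$ exists and is the circle $S^1$ (with its intrinsic length metric).
   Context: Graphs carry the graph metric; $|X_n|$ is the number of vertices. The scaling limit of $(X_n)$: rescale the metric of $X_n$ by $1/\operatorname{diam}(X_n)$ to obtain $X'_n$ of diameter 1; a compact metric space is the scaling limit if $X'_n$ converges to it in the Gromov–Hausdorff distance. *)

(* Defs.v *)
From HB Require Import structures.
From mathcomp Require Import all_boot all_order all_algebra all_fingroup.
From mathcomp Require Import all_classical all_reals all_analysis.
Set Implicit Arguments. Unset Strict Implicit. Unset Printing Implicit Defensive.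
Import Order.TTheory GRing.Theory Num.Theory.

Section Graphs.
Variable T : finType.
Variable e : rel T.

Definition simple_graph : Prop := symmetric e /\ irreflexive e.

Definition connected_graph : Prop := forall x y : T, connect e x y.

Definition vertex_transitive : Prop :=
  forall x y : T, exists f : {perm T},
    f x = y /\ (forall a b : T, e (f a) (f b) = e a b).

Fixpoint nball (x : T) (k : nat) : {set T} :=
  match k with
  | 0 => [set x]
  | k.+1 => nball x k :|: [set y | [exists z in nball x k, e z y]]
  end.

(* graph distance: least k with y in nball x k (distances in a connected graph
   are < #|T|; value #|T| only for unreachable pairs) *)
Definition gdist (x y : T) : nat :=
  find (fun k => y \in nball x k) (iota 0 #|T|).

Definition gdiam : nat := (\max_(x : T) \max_(y : T) gdist x y)%N.
End Graphs.

Local Open Scope ring_scope.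
Local Open Scope classical_set_scope.

Section GH.
Variable R : realType.

Definition admissible (X Y : Type) (dX : X -> X -> R) (dY : Y -> Y -> R)
    (d : X + Y -> X + Y -> R) : Prop :=
  (forall z w, 0 <= d z w) /\ (forall z, d z z = 0) /\
  (forall z w, d z w = d w z) /\ (forall z w u, d z u <= d z w + d w u) /\
  (forall a b, d (inl a) (inl b) = dX a b) /\
  (forall a b, d (inr a) (inr b) = dY a b).

Definition hausdorff_dist (Z : Type) (d : Z -> Z -> R) (A B : set Z) : R :=
  Num.max (sup [set inf [set d a b | b in B] | a in A])
          (sup [set inf [set d a b | a in A] | b in B]).

Definition GH_dist (X Y : Type) (dX : X -> X -> R) (dY : Y -> Y -> R) : R :=
  inf [set hausdorff_dist d (range inl) (range inr)
      | d in [set d | admissible dX dY d]].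

(* The circle with its intrinsic length metric, of total length 2
   (hence diameter 1): points of [0,2), arc-length distance. *)
Definition circle : Type := {t : R | (0 <= t) && (t < 2)}.
Definition circle_dist (s t : circle) : R :=
  Num.min `|sval s - sval t| (2 - `|sval s - sval t|).
End GH.

Definition rescaled_dist (R : realType) (T : finType) (e : rel T) (x y : T) : R :=
  (gdist e x y)%:R / (gdiam e)%:R.

(* Main.v *)
Require Import Defs.
From HB Require Import structures.
From mathcomp Require Import all_boot all_order all_algebra all_fingroup.
From mathcomp Require Import all_classical all_reals all_analysis.
From mathcomp Require Import zify lra.
Set Implicit Arguments. Unset Strict Implicit. Unset Printing Implicit Defensive.
Import Order.TTheory GRing.Theory Num.Theory.

(* Call a vertex with three points at distance r from it, pairwise at distance
   at least r, a caret of size r.  By transitivity a caret anywhere gives one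
   everywhere, and the balls of radius r / 2 around its four points are disjoint
   in a ball of radius 3 r / 2.  So carets at all scales 1, 3, ..., 3^(k-1) give
   4^k vertices, and the volume hypothesis forces some scale r = o(diam)
   without carets (note 2 - 1 / log_3 4 <= log_3 4).

   Without carets of size r, a point whose nearest point on a geodesic is not
   near its ends is at distance less than r from it.  Let g be a geodesic from p
   to q of length D = diam.  Every vertex is the midpoint of a long geodesic, so
   some p' near p lies off g, "beyond" p.  A geodesic h from p' to q cannot pass
   near p (it would be longer than D), hence meets the neighbourhood of g only
   near q.  Geodesics between g and h must pass near p or q, so g and h form,
   up to O(r), an isometric circle of length 2 D; and it is O(r)-dense. *)

(** * Integer-valued geodesic metrics *)

Record geodesic_metric (T : Type) (d : T -> T -> nat) : Prop := GeodesicMetric {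
  gm_eq0 : forall x y, d x y = 0 <-> x = y;
  gm_sym : forall x y, d x y = d y x;
  gm_tri : forall x y z, d x z <= d x y + d y z;
  gm_between : forall x y k, k <= d x y ->
    exists z, d x z = k /\ d z y = d x y - k }.

Definition homogeneous (T : Type) (d : T -> T -> nat) : Prop :=
  forall x y, exists f : T -> T, f x = y /\ forall a b, d (f a) (f b) = d a b.

Definition geodesic (T : Type) (d : T -> T -> nat) (g : nat -> T) (L : nat) : Prop :=
  forall i j, i <= j -> j <= L -> d (g i) (g j) = j - i.

Definition caret (T : Type) (d : T -> T -> nat) (r : nat) : Prop :=
  exists v a b c, [/\ d v a = r, d v b = r & d v c = r] /\
    [/\ r <= d a b, r <= d a c & r <= d b c].

Section GeodesicMetric.
Variables (T : Type) (d : T -> T -> nat).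
Hypothesis gm : geodesic_metric d.

Let dC := gm_sym gm.
Let dD := gm_tri gm.

Lemma gm_refl x : d x x = 0.
Proof. exact/(gm_eq0 gm). Qed.

(** Induction on the distance: [y] is appended to a geodesic ending one step before it. *)
Lemma geodesic_exists x y :
  exists g, [/\ g 0 = x, g (d x y) = y & geodesic d g (d x y)].
Proof.
have [n] := ubnP (d x y); move: y; elim: n => // n IH y.
case: (posnP (d x y)) => [E _|pos lt].
  exists (fun _ => x); split => //; first exact/(gm_eq0 gm).
  by move=> i j ij jL; rewrite gm_refl; lia.
have [z [xz zy]] := gm_between gm (leq_pred (d x y)).
have [g [g0 gz Gg]] := IH z ltac:(lia).
exists (fun i => if i == d x y then y else g i); rewrite eqxx; split => //.
  by case: eqP => //; lia.
have ext i : i < d x y -> d (g i) y = d x y - i.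
  move=> lti; have := Gg i (d x z) ltac:(lia) (leqnn _); rewrite gz => di.
  have := Gg 0 i isT ltac:(lia); rewrite g0 => d0.
  have := dD (g i) z y; have := dD x (g i) y; lia.
move=> i j ij jL; case: eqP => [Ei|ne]; case: eqP => [Ej|ne'].
- by rewrite gm_refl; lia.
- lia.
- by rewrite ext; lia.
- by apply: Gg; lia.
Qed.

Lemma nearest_point (g : nat -> T) (L : nat) (x : T) :
  exists2 t, t <= L & forall s, s <= L -> d x (g t) <= d x (g s).
Proof.
elim: L => [|L [t tL min]]; first by exists 0 => // s; rewrite leqn0 => /eqP->.
have [le|lt] := leqP (d x (g t)) (d x (g L.+1)).
  exists t; first lia.
  by move=> s; rewrite leq_eqVlt => /predU1P[->//|]; rewrite ltnS; apply: min.
exists L.+1 => // s; rewrite leq_eqVlt => /predU1P[->//|]; rewrite ltnS => sL.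
by have := min _ sL; lia.
Qed.

(** * Neighbourhoods of geodesics in the absence of carets *)

Section NoCaret.
Variable r : nat.
Hypotheses (r_gt0 : 0 < r) (ncaret : ~ caret d r).

(** Otherwise let [w] lie at distance [r] from [g t] on the way to [x]. Since [g (t - r)] and
    [g (t + r)] are no nearer to [x] than [g t] is, both are at least [r] away from [w], and the
    three points form a caret at [g t]. *)
Lemma nearest_interior g L x t : geodesic d g L ->
  (forall s, s <= L -> d x (g t) <= d x (g s)) ->
  r <= t -> t + r <= L -> d x (g t) < r.
Proof.
move=> Gg min rt trL; rewrite ltnNge; apply/negP => far; apply: ncaret.
have [w [tw wx]] : exists w, d (g t) w = r /\ d w x = d (g t) x - r.
  by apply: (gm_between gm); rewrite dC.
exists (g t), (g (t - r)), (g (t + r)), w.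
have e1 := Gg (t - r) t ltac:(lia) ltac:(lia).
have e2 := Gg t (t + r) ltac:(lia) ltac:(lia).
have e3 := Gg (t - r) (t + r) ltac:(lia) ltac:(lia).
have m1 := min (t - r) ltac:(lia); have m2 := min (t + r) ltac:(lia).
have c0 := dC (g t) x; have c1 := dC x w.
have c2 := dC w (g (t - r)); have c3 := dC w (g (t + r)).
have c4 := dC (g t) (g (t - r)).
have t1 := dD x w (g (t - r)); have t2 := dD x w (g (t + r)).
by split; split; lia.
Qed.

(* At the first exit of the walk h from the r-neighbourhood of g the distance to
   g is exactly r, which nearest_interior forbids away from the ends of g. *)
Lemma exit_near_ends g L h M : geodesic d g L ->
  (forall i, i < M -> d (h i) (h i.+1) <= 1) ->
  (exists2 s, s <= L & d (h 0) (g s) < r) ->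
  (forall s, s <= L -> r <= d (h M) (g s)) ->
  exists2 i, i <= M & d (h i) (g 0) < 2 * r \/ d (h i) (g L) < 2 * r.
Proof.
move=> Gg; elim: M => [_ [s sL lt]|M IH step start far].
  by move=> /(_ s sL); lia.
have [t tL min] := nearest_point g L (h M).
have [far'|near] := leqP r (d (h M) (g t)).
  have step' i : i < M -> d (h i) (h i.+1) <= 1 by move=> iM; apply: step; lia.
  have [s sL|i iM near] := IH step' start; first exact: leq_trans far' (min _ sL).
  by exists i => //; lia.
exists M.+1 => //.
have [u uL umin] := nearest_point g L (h M.+1).
have dr : d (h M.+1) (g u) = r.
  have := far _ uL; have := umin _ tL; have := step M (leqnn _).
  by have := dD (h M.+1) (h M) (g t); have := dC (h M) (h M.+1); lia.
have [ru|ur] := leqP r u.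
  have [uL'|uL'] := leqP (u + r) L.
    by have := nearest_interior Gg umin ru uL'; lia.
  right; have := Gg u L uL (leqnn _); have := dD (h M.+1) (g u) (g L); lia.
left; have := Gg 0 u isT uL; have := dC (g 0) (g u).
by have := dD (h M.+1) (g u) (g 0); lia.
Qed.

(* Everything near the midpoint of a long geodesic lies on one of its two
   sides, where the distance to the midpoint is a coordinate. *)
Lemma pigeonhole_midpoint g m c K x1 x2 x3 : geodesic d g (2 * m) -> g m = c ->
  2 * K + r <= m -> d c x1 <= K -> d c x2 <= K -> d c x3 <= K ->
  let close x y := d x y <= (d c x - d c y) + (d c y - d c x) + 4 * r in
  [\/ close x1 x2, close x1 x3 | close x2 x3].
Proof.
move=> Gg gm_c Km k1 k2 k3 close.
(* The nearest point [g t] is within [2 * K] of [c], so [2 * K + r <= m] keeps it away from the ends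
   of [g]. With truncated subtraction, [(t - m) + (m - t)] is |t - m|. *)
have side x : d c x <= K -> exists t, [/\ t <= 2 * m, d x (g t) < r &
   (t - m) + (m - t) <= d c x + r /\ d c x <= (t - m) + (m - t) + r].
  move=> kx; have [t tL min] := nearest_point g (2 * m) x.
  have := min m ltac:(lia); rewrite gm_c => xt.
  have cx := dC c x; have cxt := dC x (g t).
  have gt : d c (g t) = (t - m) + (m - t).
    rewrite -gm_c; have [mt|tm] := leqP m t.
      by rewrite Gg //; lia.
    by rewrite dC Gg //; lia.
  have t1 := dD c x (g t); have t2 := dD c (g t) x.
  have lt : d x (g t) < r by apply: (nearest_interior Gg min); lia.
  by exists t; split => //; split; lia.
have [t1 [l1 n1 [a1 b1]]] := side _ k1.
have [t2 [l2 n2 [a2 b2]]] := side _ k2.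
have [t3 [l3 n3 [a3 b3]]] := side _ k3.
have pair x y t u : t <= 2 * m -> u <= 2 * m -> d x (g t) < r -> d y (g u) < r ->
    d x y < (t - u) + (u - t) + 2 * r.
  move=> tL uL xt yu; have := dD x (g t) y; have := dD (g t) (g u) y.
  have := dC (g u) y; have := dC (g t) (g u).
  by have [tu|ut] := leqP t u; [have := Gg t u tu uL|have := Gg u t (ltnW ut) tL]; lia.
have p12 := pair _ _ _ _ l1 l2 n1 n2.
have p13 := pair _ _ _ _ l1 l3 n1 n3.
have p23 := pair _ _ _ _ l2 l3 n2 n3.
rewrite /close.
(* Two of the three parameters are on the same side of [m]. For these, projecting to [g] costs
   [2 * r], and replacing |t - m| by the distance to [c] another [2 * r]. *)
have [m1|m1] := leqP m t1; have [m2|m2] := leqP m t2; have [m3|m3] := leqP m t3;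
  solve [apply: Or31; lia | apply: Or32; lia | apply: Or33; lia].
Qed.

End NoCaret.
End GeodesicMetric.

(** * The coarse circle built from two geodesics *)

Definition on_arcs (T : Type) (g1 : nat -> T) (L1 : nat) (g2 : nat -> T) (L2 : nat) (z : T) : Prop :=
  (exists2 s, s <= L1 & z = g1 s) \/ (exists2 t, t <= L2 & z = g2 t).

(* g1 runs from p to q and g2 from a point near p to q: up to an error C they
   form a closed loop of length 2 D with the metric of a circle, g1 s and g2 t
   being s + t apart through p and 2 D - (s + t) apart through q. *)
Record coarse_loop (T : Type) (d : T -> T -> nat) (D C : nat)
    (g1 g2 : nat -> T) (L : nat) : Prop := CoarseLoop {
  cl_geod1 : geodesic d g1 D;
  cl_geod2 : geodesic d g2 L;
  cl_leD : L <= D;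
  cl_geL : D <= L + C;
  cl_upper : forall s t, s <= D -> t <= L ->
    d (g1 s) (g2 t) <= minn (s + t) (2 * D - (s + t)) + C;
  cl_lower : forall s t, s <= D -> t <= L ->
    minn (s + t) (2 * D - (s + t)) <= d (g1 s) (g2 t) + C;
  cl_dense : forall x, exists2 z, on_arcs g1 D g2 L z & d x z <= C }.

Section Loop.
Variables (T : Type) (d : T -> T -> nat).
Hypotheses (gm : geodesic_metric d) (hom : homogeneous d).
Variables (r D : nat) (p q : T).
Hypotheses (r_gt0 : 0 < r) (ncaret : ~ caret d r).
Hypotheses (leD : forall x y, d x y <= D) (pqD : d p q = D) (rD : 86 * r <= D).

Let dC := gm_sym gm.
Let dD := gm_tri gm.

(** A piece of a diametral geodesic, its midpoint moved to [c] by homogeneity. *)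
Lemma midpoint_geodesic c m : 2 * m <= D -> exists2 g, geodesic d g (2 * m) & g m = c.
Proof.
move=> mD; have [g [_ _]] := geodesic_exists gm p q; rewrite pqD => Gg.
have [f [fc fd]] := hom (g m) c; exists (f \o g) => // i j ij jm /=.
by rewrite fd Gg //; lia.
Qed.

Lemma pigeonhole_ball c x1 x2 x3 :
  d c x1 <= 21 * r -> d c x2 <= 21 * r -> d c x3 <= 21 * r ->
  let close x y := d x y <= (d c x - d c y) + (d c y - d c x) + 4 * r in
  [\/ close x1 x2, close x1 x3 | close x2 x3].
Proof.
(* Radius [21 * r] needs half-length [(2 * 21 + 1) * r]; hence the bound [86 * r <= D]. *)
have [g Gg gmid] := @midpoint_geodesic c (43 * r) ltac:(lia).
by apply: (pigeonhole_midpoint gm r_gt0 ncaret Gg gmid); lia.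
Qed.

Section Arcs.
Variables (g h : nat -> T) (L : nat).
Hypotheses (Gg : geodesic d g D) (Gh : geodesic d h L).
Hypotheses (g0 : g 0 = p) (gD : g D = q) (hL : h L = q).
Hypotheses (ph0 : d p (h 0) = 5 * r) (h0far : forall s, s <= D -> r <= d (h 0) (g s)).

Let hq t : t <= L -> d (h t) q = L - t.
Proof. by move=> tL; rewrite -hL Gh. Qed.

Let gq s : s <= D -> d (g s) q = D - s.
Proof. by move=> sD; rewrite -gD Gg. Qed.

Let gp s : s <= D -> d p (g s) = s.
Proof. by move=> sD; rewrite -g0 Gg ?subn0. Qed.

Let L_bounds : L <= D /\ D <= L + 5 * r.
Proof.
have := hq (leq0n L); rewrite subn0 => e.
have := leD (h 0) q; have := dD p (h 0) q; lia.
Qed.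

Let ph t : t <= L -> d p (h t) <= t + 5 * r /\ t <= d p (h t) + 5 * r.
Proof.
move=> tL; have e := Gh (leq0n t) tL; have := dD p (h 0) (h t).
by have := dD (h 0) p (h t); have := dC p (h 0); lia.
Qed.

(* If h came within 2r of p, it would be longer than the diameter. *)
Let h_avoids_p t : t <= L -> 2 * r <= d (h t) p.
Proof.
move=> tL; rewrite leqNgt; apply/negP => near.
have e := Gh (leq0n t) tL; have := hq tL; have := leD (h 0) q.
have := hq (leq0n L); have := dD p (h t) q.
by have := dD p (h t) (h 0); have := dC (h t) (h 0); have := dC p (h t); lia.
Qed.

(** Followed backwards from [h t], the geodesic [h] must leave the neighbourhood of [g] before
    reaching [h 0]. It does so near [p] or [q], and [p] is excluded. *)
Let h_near_g t s : t <= L -> s <= D -> d (h t) (g s) < r -> L - t < 2 * r.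
Proof.
move=> tL sD near.
have [||s' s'D|i it] := exit_near_ends gm r_gt0 ncaret (h := fun i => h (t - i)) (M := t) Gg.
- by move=> i it; rewrite dC Gh; lia.
- by exists s => //; rewrite subn0.
- by rewrite subnn; apply: h0far.
rewrite g0 gD => -[]; first by have := @h_avoids_p (t - i) ltac:(lia); lia.
by rewrite hq; lia.
Qed.

Let upper s t : s <= D -> t <= L ->
  d (g s) (h t) <= minn (s + t) (2 * D - (s + t)) + 5 * r.
Proof.
move=> sD tL; have [b1 b2] := L_bounds.
have := dD (g s) p (h t); have := dC p (g s); have := gp sD; have := ph tL.
have := dD (g s) q (h t); have := dC q (h t); have := gq sD; have := hq tL.
by lia.
Qed.

(** A geodesic from [g s] to [h t] leaves the neighbourhood of [g] within [2 * r] of [p] or [q]. The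
    detour through that point costs at most [4 * r], and the offset of [h 0] from [p] another
    [5 * r]. If [h t] is itself near [g], it is near [q]. *)
Let lower s t : s <= D -> t <= L ->
  minn (s + t) (2 * D - (s + t)) <= d (g s) (h t) + 9 * r.
Proof.
move=> sD tL; have [b1 b2] := L_bounds.
have es := gq sD; have et := hq tL; have ep := gp sD; have [_ pt] := ph tL.
have [[s' s'D near]|far] := pselect (exists2 s', s' <= D & d (h t) (g s') < r).
  by have := h_near_g tL s'D near; have := dD (g s) (h t) q; lia.
have [k [k0 kM Gk]] := geodesic_exists gm (g s) (h t).
have [||s' s'D|i iM] := exit_near_ends gm r_gt0 ncaret (h := k) (M := d (g s) (h t)) Gg.
- by move=> i it; rewrite Gk; lia.
- by exists s; rewrite // k0 gm_refl.
- by rewrite kM leqNgt; apply/negP => near; apply: far; exists s'.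
have e1 := Gk 0 i isT iM; have e2 := Gk i _ iM (leqnn _).
rewrite k0 in e1; rewrite kM in e2.
have c1 := dC p (k i); have c2 := dC q (k i).
have c3 := dC p (g s); have c4 := dC q (h t).
have t1 := dD (g s) (k i) p; have t2 := dD (g s) (k i) q.
have t3 := dD p (k i) (h t); have t4 := dD q (k i) (h t).
by rewrite g0 gD => -[near|near]; lia.
Qed.

(** Each arc has a point at distance [16 * r] from [c], up to [5 * r]. These two points are too far
    apart to be the close pair of [pigeonhole_ball], so [y] is within [5 * r + 4 * r] of one of
    them. *)
Let arcs_near_end c : c = p \/ c = q -> forall y, d c y = 16 * r ->
  exists2 z, on_arcs g D h L z & d y z <= 9 * r.
Proof.
move=> cpq y cy; have [b1 b2] := L_bounds.
have [s [t [sD tL cs [ct1 ct2] apart]]] : exists s t, [/\ s <= D, t <= L,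
    d c (g s) = 16 * r, d c (h t) <= 21 * r /\ 11 * r <= d c (h t) &
    9 * r < d (g s) (h t)].
  case: cpq => ->.
    exists (16 * r), (16 * r); have := ph (t := 16 * r) ltac:(lia).
    have := @lower (16 * r) (16 * r) ltac:(lia) ltac:(lia).
    by rewrite gp; [split => //; lia|lia].
  exists (D - 16 * r), (L - 16 * r).
  have := @lower (D - 16 * r) (L - 16 * r) ltac:(lia) ltac:(lia).
  have := @gq (D - 16 * r) ltac:(lia); have := @hq (L - 16 * r) ltac:(lia).
  by rewrite ![d _ q]dC; split; lia.
have := @pigeonhole_ball c y (g s) (h t) ltac:(lia) ltac:(lia) ltac:(lia).
move=> /= [close|close|close]; last lia.
- by exists (g s); [left; exists s|lia].
- by exists (h t); [right; exists t|lia].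
Qed.

(** The point [n] of the arcs nearest to a far [x] is within [6 * r] of some [c] among [p] and [q].
    Going from [c] towards [x] for [16 * r] leads to a point within [9 * r] of the arcs; as
    [9 + 6 < 16], some arc point is nearer to [x] than [n]. *)
Let dense x : exists2 z, on_arcs g D h L z & d x z <= 16 * r.
Proof.
have [s sD smin] := nearest_point d g D x.
have [t tL tmin] := nearest_point d h L x.
have ong u : u <= D -> on_arcs g D h L (g u) by move=> uD; left; exists u.
have onh u : u <= L -> on_arcs g D h L (h u) by move=> uD; right; exists u.
have [near|farg] := leqP (d x (g s)) (16 * r); first by exists (g s); auto.
have [near|farh] := leqP (d x (h t)) (16 * r); first by exists (h t); auto.
have ends_g : d (g s) p < r \/ d (g s) q < r.
  have [rs|sr] := leqP r s; last by left; rewrite dC gp.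
  have [sr|sr] := leqP (s + r) D; last by right; rewrite gq //; lia.
  by have := nearest_interior gm r_gt0 ncaret Gg smin rs sr; lia.
have ends_h : d (h t) p < 6 * r \/ d (h t) q < r.
  have [rt|tr] := leqP r t; last by left; have := ph tL; rewrite dC; lia.
  have [tr|tr] := leqP (t + r) L; last by right; rewrite hq //; lia.
  by have := nearest_interior gm r_gt0 ncaret Gh tmin rt tr; lia.
have [n [c [nmin cpq nc]]] : exists n c, [/\ forall z, on_arcs g D h L z -> d x n <= d x z,
    c = p \/ c = q & d n c < 6 * r].
  have [le|lt] := leqP (d x (g s)) (d x (h t)).
    exists (g s); have [near|near] := ends_g; [exists p|exists q]; split; auto; try lia;
      move=> z [[u uD ->]|[u uL ->]]; [exact: smin|exact: leq_trans le (tmin _ uL)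
                                    |exact: smin|exact: leq_trans le (tmin _ uL)].
  exists (h t); have [near|near] := ends_h; [exists p|exists q]; split; auto; try lia;
    move=> z [[u uD ->]|[u uL ->]]; [exact: leq_trans (ltnW lt) (smin _ uD)|exact: tmin
                                    |exact: leq_trans (ltnW lt) (smin _ uD)|exact: tmin].
have onc : on_arcs g D h L c.
  by case: cpq => ->; [rewrite -g0|rewrite -gD]; apply: ong.
have [near|far] := leqP (d x c) (16 * r); first by exists c.
have [y [cy yx]] : exists y, d c y = 16 * r /\ d y x = d c x - 16 * r.
  by apply: (gm_between gm); rewrite dC; lia.
have [z zon yz] := arcs_near_end cpq cy.
have := nmin z zon; have := dD x y z; have := dC x y; have := dC c x.
by have := dD x n c; lia.
Qed.

Lemma coarse_loop_arcs : coarse_loop d D (16 * r) g h L.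
Proof.
have [b1 b2] := L_bounds.
split => //; first lia.
- by move=> s t sD tL; have := upper sD tL; lia.
- by move=> s t sD tL; have := lower sD tL; lia.
Qed.

End Arcs.

(* The second geodesic starts at a point p' next to p which the first one
   misses: one of the two directions available at p. *)
Lemma coarse_loop_exists : exists g h L, coarse_loop d D (16 * r) g h L.
Proof.
have [g [g0 gD Gg]] := geodesic_exists gm p q; rewrite pqD in gD Gg.
have [u Gu up] := @midpoint_geodesic p (5 * r) ltac:(lia).
have [p' [pp' far]] : exists p', d p p' = 5 * r /\ forall s, s <= D -> r <= d p' (g s).
  have e1 := Gu 0 (5 * r) ltac:(lia) ltac:(lia).
  have e2 := Gu (5 * r) (2 * (5 * r)) ltac:(lia) ltac:(lia).
  have e3 := Gu 0 (2 * (5 * r)) ltac:(lia) ltac:(lia).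
  rewrite up in e1 e2; rewrite dC in e1.
  have near_pos x s : d p x = 5 * r -> s <= D -> d x (g s) < r -> 4 * r < s < 6 * r.
    move=> px sD xs; have := Gg 0 s isT sD; rewrite g0.
    by have := dD p x (g s); have := dD p (g s) x; have := dC x (g s); lia.
  (* If both ends of [u] were near [g], they would be near points with parameters between [4 * r]
     and [6 * r], hence less than [4 * r] apart instead of [10 * r]. *)
  have [far|near] := pselect (forall s, s <= D -> r <= d (u 0) (g s)).
    by exists (u 0); split => //; lia.
  exists (u (2 * (5 * r))); split; first lia.
  move=> s sD; rewrite leqNgt; apply/negP => ns; apply: near => s' s'D.
  rewrite leqNgt; apply/negP => ns'.
  have b1 := near_pos (u (2 * (5 * r))) _ ltac:(lia) sD ns.
  have b2 := near_pos (u 0) _ ltac:(lia) s'D ns'.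
  have t1 := dD (u 0) (g s') (u (2 * (5 * r))).
  have t2 := dD (g s') (g s) (u (2 * (5 * r))).
  have c1 := dC (g s) (u (2 * (5 * r))); have c2 := dC (g s) (g s').
  by have [ss|ss] := leqP s s';
    [have := Gg s s' ss s'D|have := Gg s' s (ltnW ss) sD]; lia.
have [h [h0 hL Gh]] := geodesic_exists gm p' q.
exists g, h, (d p' q); apply: coarse_loop_arcs => //; first by rewrite h0.
by rewrite h0.
Qed.

End Loop.

(** * Volume growth from carets *)

Section Growth.
Variables (T : finType) (d : T -> T -> nat).
Hypotheses (gm : geodesic_metric d) (hom : homogeneous d).

Let dC := gm_sym gm.
Let dD := gm_tri gm.

(* Radius 3^k / 2 makes the balls centred at the vertex and at the tips of a
   caret of size 3^k disjoint and contained in the ball of radius 3^(k+1) / 2. *)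
Lemma card_ball_carets k : (forall j, j < k -> caret d (3 ^ j)) ->
  forall x, 4 ^ k <= #|[set y | 2 * d x y < 3 ^ k]|.
Proof.
elim: k => [_ x|k IH carets x].
  by apply/card_gt0P; exists x; rewrite inE gm_refl.
have [v [a0 [b0 [c0 [[va0 vb0 vc0] [ab0 ac0 bc0]]]]]] := carets k (leqnn _).
have [f [fv fd]] := hom v x.
pose a := f a0; pose b := f b0; pose c := f c0.
have va : d x a = 3 ^ k by rewrite -fv fd.
have vb : d x b = 3 ^ k by rewrite -fv fd.
have vc : d x c = 3 ^ k by rewrite -fv fd.
have ab : 3 ^ k <= d a b by rewrite fd.
have ac : 3 ^ k <= d a c by rewrite fd.
have bc : 3 ^ k <= d b c by rewrite fd.
have {}IH := IH (fun j jk => carets j (ltnW jk)).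
pose B y := [set z | 2 * d y z < 3 ^ k].
have disj y z : 3 ^ k <= d y z -> B y :&: B z = finset.set0.
  move=> yz; apply/setP => w; rewrite !inE; apply/negP => /andP[yw zw].
  by have := dD y w z; have := dC w z; lia.
have sub y : d x y <= 3 ^ k -> B y \subset [set z | 2 * d x z < 3 ^ k.+1].
  move=> xy; apply/fintype.subsetP => w; rewrite !inE => yw.
  by have := dD x y w; rewrite expnS; lia.
have /subset_leq_card le : (B x :|: B a) :|: (B b :|: B c)
    \subset [set z | 2 * d x z < 3 ^ k.+1].
  by rewrite !finset.subUset !sub // ?va ?vb ?vc // gm_refl.
apply: leq_trans le.
rewrite cardsU finset.setIUl !finset.setIUr !disj ?va ?vb ?vc // !finset.setU0 cards0 subn0.
rewrite !cardsU !disj ?va ?vb ?vc // cards0 !subn0 expnS.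
by have := IH x; have := IH a; have := IH b; have := IH c; rewrite /B; lia.
Qed.

End Growth.

(** * The graph distance as a homogeneous geodesic metric *)

Section GraphDistance.
Variables (T : finType) (e : rel T).

Lemma nball_cat x y z k l :
  y \in nball e x k -> z \in nball e y l -> z \in nball e x (k + l).
Proof.
move=> xy; elim: l z => [z|l IH z]; first by rewrite inE addn0 => /eqP->.
rewrite addnS /= !inE => /orP[/IH -> //|/existsP[w /andP[wl ewz]]].
by apply/orP; right; apply/existsP; exists w; rewrite IH.
Qed.

Lemma nball_leq x y k l : k <= l -> y \in nball e x k -> y \in nball e x l.
Proof.
move=> /subnKC <- xy; apply: nball_cat xy _.
by elim: (l - k) => [|n IH] /=; rewrite !inE ?eqxx ?IH.
Qed.

Lemma nball_split x z k l : z \in nball e x (k + l) ->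
  exists2 y, y \in nball e x k & z \in nball e y l.
Proof.
elim: l z => [z|l IH z]; first by rewrite addn0 => xz; exists z; rewrite ?inE.
rewrite addnS /= !inE => /orP[/IH[y xy yz]|/existsP[w /andP[/IH[y xy yw] ewz]]].
  by exists y; rewrite //= inE yz.
exists y => //=; rewrite !inE; apply/orP; right.
by apply/existsP; exists w; rewrite yw.
Qed.

Lemma nball1 x y : e x y -> y \in nball e x 1.
Proof.
move=> exy; rewrite /= !inE; apply/orP; right.
by apply/existsP; exists x; rewrite inE eqxx.
Qed.

Lemma nball_path x p : path e x p -> last x p \in nball e x (size p).
Proof.
elim: p x => [x|y p IH x] /=; first by rewrite inE.
by case/andP => exy /IH; apply: (nball_cat (k := 1) (nball1 exy)).
Qed.

Lemma nball_sym x y k : symmetric e -> (y \in nball e x k) = (x \in nball e y k).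
Proof.
move=> se; suff sub u v : u \in nball e v k -> v \in nball e u k.
  by apply/idP/idP; apply: sub.
elim: k u => [u|k IH u]; first by rewrite !inE eq_sym.
rewrite /= !inE => /orP[/IH -> //|/existsP[w /andP[/IH wv ewu]]].
have uw : w \in nball e u 1 by apply: nball1; rewrite se.
by have := nball_cat uw wv; rewrite add1n /= !inE.
Qed.

Lemma nball_aut (f : T -> T) : (forall a b, e (f a) (f b) = e a b) ->
  forall x y k, y \in nball e x k -> f y \in nball e (f x) k.
Proof.
move=> fe x y k; elim: k y => [y|k IH y]; first by rewrite !inE => /eqP->.
rewrite /= !inE => /orP[/IH -> //|/existsP[w /andP[/IH wv ewu]]].
by apply/orP; right; apply/existsP; exists (f w); rewrite wv fe.
Qed.

Hypotheses (se : symmetric e) (ce : connected_graph e).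

(** A path without repeated vertices has fewer than [#|T|] edges, so the search defining [gdist]
    succeeds. *)
Lemma gdist_le x y k : (gdist e x y <= k) = (y \in nball e x k).
Proof.
pose P n := y \in nball e x n.
have ex : exists2 n, n < #|T| & P n.
  have /connectP[p ep y_def] := ce x y.
  case: (shortenP ep) y_def => p' ep' up' _ y_def; rewrite /P y_def.
  exists (size p'); last exact: nball_path.
  by have := max_card (mem (x :: p')); rewrite (card_uniqP up').
have hasP : has P (iota 0 #|T|).
  by case: ex => n lt Pn; apply/hasP; exists n; rewrite // mem_iota.
have lt : find P (iota 0 #|T|) < #|T| by rewrite -{2}(size_iota 0 #|T|) -has_find.
have := nth_find 0 hasP; rewrite nth_iota // add0n => Pf.
apply/idP/idP => [le|yk]; first exact: nball_leq le Pf.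
rewrite leqNgt; apply/negP => kf.
by have := before_find 0 kf; rewrite nth_iota ?add0n ?yk //; apply: ltn_trans kf lt.
Qed.

Lemma gdist_geodesic : geodesic_metric (gdist e).
Proof.
split.
- move=> x y; split => [d0|->].
    by have := leqnn (gdist e x y); rewrite {2}d0 gdist_le inE => /eqP.
  by apply/eqP; rewrite -leqn0 gdist_le inE.
- by move=> x y; apply/eqP; rewrite eqn_leq !gdist_le nball_sym // -gdist_le leqnn
    /= nball_sym // -gdist_le.
- by move=> x y z; rewrite gdist_le; apply: (@nball_cat _ y); rewrite -gdist_le.
- move=> x y k kd.
  have := leqnn (gdist e x y); rewrite -{2}(subnKC kd) gdist_le => /nball_split[z xz zy].
  exists z; move: (xz) (zy); rewrite -!gdist_le => xz' zy'.
  have : gdist e x y <= gdist e x z + gdist e z y.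
    by rewrite gdist_le; apply: (@nball_cat _ z); rewrite -gdist_le.
  lia.
Qed.

Lemma gdist_homogeneous : vertex_transitive e -> homogeneous (gdist e).
Proof.
move=> vt x y; have [f [fx fe]] := vt x y; exists f; split => // a b.
have ife a' b' : e ((f^-1)%g a') ((f^-1)%g b') = e a' b' by rewrite -fe !permKV.
apply/eqP; rewrite eqn_leq !gdist_le; apply/andP; split.
  by apply: nball_aut => //; rewrite -gdist_le.
by have := nball_aut ife (x := f a) (y := f b); rewrite !permK; apply; rewrite -gdist_le.
Qed.

Lemma gdist_le_gdiam x y : gdist e x y <= gdiam e.
Proof. exact: leq_trans (leq_bigmax y) (@leq_bigmax _ (fun x => \max_y gdist e x y) x). Qed.

Lemma gdiam_attained (x0 : T) : exists p q, gdist e p q = gdiam e.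
Proof.
have T0 : 0 < #|T| by apply/card_gt0P; exists x0.
have [p ->] : {p | gdiam e = \max_y gdist e p y} := bigop.eq_bigmax (fun x => \max_y gdist e x y) T0.
by have [q ->] := bigop.eq_bigmax (gdist e p) T0; exists p, q.
Qed.

End GraphDistance.

Local Open Scope ring_scope.
Local Open Scope classical_set_scope.

(** * Gromov-Hausdorff bounds from approximate isometries *)

Record pseudometric (R : realType) (X : Type) (d : X -> X -> R) : Prop := Pseudometric {
  pm_ge0 : forall x y, 0 <= d x y;
  pm_refl : forall x, d x x = 0;
  pm_sym : forall x y, d x y = d y x;
  pm_tri : forall x y z, d x z <= d x y + d y z }.

(** Where no supremum or infimum exists, [sup] and [inf] take the default value 0, which respects
    the bound. *)
Lemma hausdorff_dist_ge0 (R : realType) (Z : Type) (d : Z -> Z -> R) (A B : set Z) :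
  (forall z w, 0 <= d z w) -> 0 <= hausdorff_dist d A B.
Proof.
move=> d_ge0; rewrite /hausdorff_dist le_max; apply/orP; left.
have inf_ge0 a : 0 <= inf [set d a b | b in B].
  have [[b Bb]|none] := pselect (B !=set0).
    by apply: lb_le_inf; [exists (d a b), b|move=> _ [c _ <-]].
  by rewrite inf_out // => -[[_ [b Bb _]]] _; apply: none; exists b.
have [hs|/sup_out -> //] := pselect (has_sup [set inf [set d a b | b in B] | a in A]).
have [[_ [a Aa _]] ub] := hs.
by apply: le_trans (inf_ge0 a) (ub_le_sup ub _); exists a.
Qed.

Lemma GH_dist_ge0 (R : realType) (X Y : Type) (dX : X -> X -> R) (dY : Y -> Y -> R) :
  0 <= GH_dist dX dY.
Proof.
have [ne|ne] := pselect ([set d | admissible dX dY d] !=set0).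
  apply: lb_le_inf; first by case: ne => d dadm; exists (hausdorff_dist d (range inl) (range inr)), d.
  by move=> _ [d [d_ge0 _] <-]; apply: hausdorff_dist_ge0.
by rewrite /GH_dist inf_out // => -[[_ [d dadm _]] _]; apply: ne; exists d.
Qed.

Section Glue.
Variables (R : realType) (X Y : Type) (dX : X -> X -> R) (dY : Y -> Y -> R).
Variables (g : Y -> X) (eps : R) (y0 : Y).
Hypotheses (pX : pseudometric dX) (pY : pseudometric dY).
Hypothesis distortion : forall y y', `|dX (g y) (g y') - dY y y'| <= 2 * eps.
Hypothesis dense : forall x, exists y, dX x (g y) <= eps.

(** Passage from [X] to [Y] is allowed between [g z] and [z] at cost [eps]; this is the cheapest
    such route. *)
Definition bridge (x : X) (y : Y) : R := inf [set dX x (g z) + eps + dY z y | z in setT].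

Definition glue (u v : X + Y) : R :=
  match u, v with
  | inl x, inl x' => dX x x'
  | inl x, inr y => bridge x y
  | inr y, inl x => bridge x y
  | inr y, inr y' => dY y y'
  end.

Let eps_ge0 : 0 <= eps.
Proof. by have [y /(le_trans (pm_ge0 pX _ _))] := dense (g y0). Qed.

Lemma bridge_le x y z : bridge x y <= dX x (g z) + eps + dY z y.
Proof.
apply: ge_inf; last by exists z.
by exists 0 => _ [w _ <-]; rewrite !addr_ge0 // ?(pm_ge0 pX) ?(pm_ge0 pY).
Qed.

Lemma le_bridge x y b : (forall z, b <= dX x (g z) + eps + dY z y) -> b <= bridge x y.
Proof.
move=> le; apply: lb_le_inf; first by exists (dX x (g y0) + eps + dY y0 y), y0.
by move=> _ [w _ <-].
Qed.

Let bridge_ge0 x y : 0 <= bridge x y.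
Proof. by apply: le_bridge => z; rewrite !addr_ge0 // ?(pm_ge0 pX) ?(pm_ge0 pY). Qed.

Let tri_XXY x x' y : bridge x y <= dX x x' + bridge x' y.
Proof.
rewrite -lerBlDl; apply: le_bridge => z.
by have := bridge_le x y z; have := pm_tri pX x x' (g z); lra.
Qed.

Let tri_XYY x y y' : bridge x y' <= bridge x y + dY y y'.
Proof.
rewrite -lerBlDr; apply: le_bridge => z.
by have := bridge_le x y' z; have := pm_tri pY z y y'; lra.
Qed.

(** Crossing at [z] and back at [w] costs [2 * eps], which pays for the distortion of [g] on [z] and
    [w]. *)
Let tri_XYX x y x' : dX x x' <= bridge x y + bridge x' y.
Proof.
rewrite -lerBlDr; apply: le_bridge => z; rewrite lerBlDr -lerBlDl; apply: le_bridge => w.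
have := distortion z w; rewrite ler_norml => /andP[_].
have := pm_tri pX x (g z) x'; have := pm_tri pX (g z) (g w) x'.
have := pm_tri pY z y w; rewrite (pm_sym pX (g w)) (pm_sym pY y); lra.
Qed.

Let tri_YXY y x y' : dY y y' <= bridge x y + bridge x y'.
Proof.
rewrite -lerBlDr; apply: le_bridge => z; rewrite lerBlDr -lerBlDl; apply: le_bridge => w.
have := distortion z w; rewrite ler_norml => /andP[+ _].
have := pm_tri pY y z y'; have := pm_tri pY z w y'.
have := pm_tri pX (g z) x (g w); rewrite (pm_sym pX (g z) x) (pm_sym pY y z); lra.
Qed.

Lemma glue_admissible : admissible dX dY glue.
Proof.
split; last split; last split; last split; last by split.
- by move=> [x|y] [x'|y'] /=; rewrite ?(pm_ge0 pX) ?(pm_ge0 pY).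
- by move=> [x|y] /=; rewrite ?(pm_refl pX) ?(pm_refl pY).
- by move=> [x|y] [x'|y'] //=; rewrite ?(pm_sym pX x) ?(pm_sym pY y).
- move=> [x|y] [x'|y'] [x''|y''] //=.
  + exact: (pm_tri pX).
  + rewrite addrC (pm_sym pX x'); exact: tri_XXY.
  + rewrite addrC (pm_sym pY y); exact: tri_XYY.
  + exact: (pm_tri pY).
Qed.

Lemma GH_dist_le : GH_dist dX dY <= 2 * eps.
Proof.
apply: le_trans (_ : hausdorff_dist glue (range inl) (range inr) <= _).
  apply: ge_inf; last by exists glue => //; apply: glue_admissible.
  by exists 0 => _ [d [d_ge0 _] <-]; apply: hausdorff_dist_ge0.
have g_ge0 := proj1 glue_admissible.
have lb (a : X + Y) (h : X + Y -> X + Y -> R) B : (forall z w, 0 <= h z w) ->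
  has_lbound [set h a b | b in B] by move=> h0; exists 0 => _ [b _ <-].
rewrite ge_max; apply/andP; split; apply: ge_sup.
- by exists (inf [set glue (inl (g y0)) b | b in range inr]), (inl (g y0)) => //; exists (g y0).
- move=> _ [_ [x _ <-] <-]; have [y xy] := dense x.
  apply: le_trans (_ : glue (inl x) (inr y) <= _).
    by apply: ge_inf; [exact: lb|exists (inr y) => //; exists y].
  by have := bridge_le x y y; rewrite /= (pm_refl pY); lra.
- by exists (inf [set glue a (inr y0) | a in range inl]), (inr y0) => //; exists y0.
- move=> _ [_ [y _ <-] <-].
  apply: le_trans (_ : glue (inl (g y)) (inr y) <= _).
    apply: ge_inf; last by exists (inl (g y)) => //; exists (g y).
    by exists 0 => _ [b _ <-].
  by have := bridge_le (g y) y y; rewrite /= (pm_refl pX) (pm_refl pY); have := eps_ge0; lra.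
Qed.

End Glue.

(** * The circle and its map onto a coarse loop *)

Lemma circle_dist_pseudometric (R : realType) : pseudometric (@circle_dist R).
Proof.
split; rewrite /circle_dist.
- move=> [x /= /andP[x0 x2]] [y /= /andP[y0 y2]]; rewrite le_min normr_ge0 /=.
  by rewrite subr_ge0 ler_norml; apply/andP; split; lra.
- by move=> x; rewrite subrr normr0 subr0 min_l.
- by move=> x y; rewrite distrC.
- move=> [x /= /andP[x0 x2]] [y /= /andP[y0 y2]] [z /= /andP[z0 z2]].
  rewrite !minElt.
  by case: (ger0P (x - y)) => ?; case: (ger0P (y - z)) => ?; case: (ger0P (x - z)) => ?;
    case: ltP => ?; case: ltP => ?; case: ltP => ?; lra.
Qed.

Lemma rescaled_pseudometric (R : realType) (T : finType) (e : rel T) :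
  geodesic_metric (gdist e) -> pseudometric (@rescaled_dist R T e).
Proof.
move=> gm; split; rewrite /rescaled_dist.
- by move=> x y; rewrite divr_ge0.
- by move=> x; rewrite gm_refl // mul0r.
- by move=> x y; rewrite (gm_sym gm).
- by move=> x y z; rewrite -mulrDl ler_wpM2r ?invr_ge0 // -natrD ler_nat (gm_tri gm).
Qed.

Section CircleMap.
Variables (R : realType) (T : Type) (d : T -> T -> nat) (D C : nat).
Variables (g h : nat -> T) (L : nat).
Hypotheses (gm : geodesic_metric d) (cl : coarse_loop d D C g h L) (D_gt0 : (0 < D)%N).

(** The loop run at speed [D]: along [g] from [p] to [q] on [0,1], then back along [h]. The cap by
    [L] is there because [h] may be shorter than [D]. *)
Definition circle_map (u : R) : T :=
  if u <= 1 then g (Num.trunc (u * D%:R)) else h (minn L (Num.trunc ((2 - u) * D%:R))).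

Let D_gt0R : 0 < D%:R :> R.
Proof. by rewrite ltr0n. Qed.

Let circle_map1 u : 0 <= u -> u <= 1 ->
  exists2 s : nat, (s <= D)%N & circle_map u = g s /\ (s%:R <= u * D%:R < s%:R + 1).
Proof.
move=> u0 u1; rewrite /circle_map u1; exists (Num.trunc (u * D%:R)).
  by rewrite -(ler_nat R) (le_trans (_ : _ <= u * D%:R)) ?truncn_le ?mulr_ge0 // ler_piMl.
by split => //; rewrite natr1 truncn_itv // mulr_ge0.
Qed.

Let circle_map2 u : 1 < u -> u < 2 ->
  exists2 t : nat, (t <= L)%N &
    circle_map u = h t /\ (t%:R <= (2 - u) * D%:R < t%:R + C%:R + 1).
Proof.
move=> u1 u2; rewrite /circle_map leNgt u1 /=.
have pos : 0 <= (2 - u) * D%:R by apply: mulr_ge0 => //; lra.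
have small : (2 - u) * D%:R <= D%:R by rewrite ler_piMl //; lra.
set k := Num.trunc _; exists (minn L k); first exact: geq_minl.
have /andP[k1 k2] := truncn_itv pos; rewrite -/k -natr1 in k1 k2.
have := cl_geL cl; rewrite -(ler_nat R) natrD => DL.
have C0 : 0 <= C%:R :> R by [].
split => //; have [Lk|_] := leqP L k; last lra.
by rewrite -(ler_nat R) in Lk; lra.
Qed.

Let dR x y := (d x y)%:R : R.

(** The loop estimates freed of [minn] and truncated subtraction, ready for transfer to the
    reals. *)
Let mixed_dist s t : (s <= D)%N -> (t <= L)%N ->
  [/\ (d (g s) (h t) <= s + t + C)%N, (d (g s) (h t) + (s + t) <= D + D + C)%N &
     (s + t <= d (g s) (h t) + C)%N \/ (D + D <= d (g s) (h t) + C + (s + t))%N].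
Proof.
move=> sD tL; have LD := cl_leD cl.
by have := cl_upper cl sD tL; have := cl_lower cl sD tL; split; lia.
Qed.

Lemma circle_map_distortion (u v : circle R) :
  `|dR (circle_map (sval u)) (circle_map (sval v)) - D%:R * circle_dist u v|
    <= (4 * C + 4)%:R.
Proof.
wlog uv : u v / sval u <= sval v.
  move=> H; have [/H //|/ltW/H] := leP (sval u) (sval v).
  by rewrite (pm_sym (circle_dist_pseudometric R)) /dR (gm_sym gm).
case: u v uv => [u uP] [v vP] /= uv.
have /andP[u0 u2] := uP; have /andP[v0 v2] := vP.
rewrite /circle_dist /= (distrC u v) (ger0_norm (_ : 0 <= v - u)); last lra.
set c := Num.min _ _.
have c1 : D%:R * c <= (v - u) * D%:R by rewrite mulrC ler_pM2r // ge_min lexx.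
have c2 : D%:R * c <= (2 - (v - u)) * D%:R.
  by rewrite mulrC ler_pM2r // ge_min lexx orbT.
have c3 : c = v - u \/ c = 2 - (v - u).
  by rewrite /c; case: leP; [left|right].
have C0 : 0 <= C%:R :> R by [].
rewrite natrD natrM ler_norml.
have [v1|v1] := leP v 1.
  have [s sD [-> s_u]] := circle_map1 u0 (le_trans uv v1).
  have [t tD [-> t_v]] := circle_map1 v0 v1.
  have cE : D%:R * c = (v - u) * D%:R.
    by rewrite mulrC /c min_l //; lra.
  have : dR (g s) (g t) = t%:R - s%:R \/ (dR (g s) (g t) = s%:R - t%:R).
    rewrite /dR; have [st|ts] := leqP s t.
      by left; rewrite (cl_geod1 cl) // natrB.
    by right; rewrite (gm_sym gm) (cl_geod1 cl) ?natrB // ltnW.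
  have := ler0n R (d (g s) (g t)); rewrite -/(dR _ _).
  move: s_u t_v => /andP[s1 s2] /andP[t1 t2] dd0.
  have uvD : u * D%:R <= v * D%:R by rewrite ler_pM2r.
  by move=> [dd|dd]; apply/andP; split; lra.
have [t tL [-> /andP[t1 t2]]] := circle_map2 v1 v2.
have [u1|u1] := leP u 1.
  have [s sD [-> /andP[s1 s2]]] := circle_map1 u0 u1.
  (* Here [s + t] approximates [(2 - (v - u)) * D], the arc through [p]; the arc through [q] has
     length [(v - u) * D]. *)
  have [up1 up2 lo'] := mixed_dist sD tL.
  move: up1 up2 lo'; rewrite -!(ler_nat R) !natrD -/(dR _ _) => up1 up2 lo'.
  apply/andP; split; last first.
    by case: c3 => ->; lra.
  by case: lo' => lo'; lra.
have [s sL [-> /andP[s1 s2]]] := circle_map2 u1 u2.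
have cE : D%:R * c = (v - u) * D%:R by rewrite mulrC /c min_l //; lra.
have : dR (h s) (h t) = t%:R - s%:R \/ (dR (h s) (h t) = s%:R - t%:R).
  rewrite /dR; have [st|ts] := leqP s t.
    by left; rewrite (cl_geod2 cl) // natrB.
  by right; rewrite (gm_sym gm) (cl_geod2 cl) ?natrB // ltnW.
have := ler0n R (d (h s) (h t)); rewrite -/(dR _ _) => dd0.
have uvD : u * D%:R <= v * D%:R by rewrite ler_pM2r.
by move=> [dd|dd]; apply/andP; split; lra.
Qed.

Lemma circle_map_dense (x : T) : exists u : circle R,
  (d x (circle_map (sval u)) <= 2 * C)%N.
Proof.
have [z zon xz] := cl_dense cl x.
suff [u uz] : exists u : circle R, (d z (circle_map (sval u)) <= C)%N.
  by exists u; have := gm_tri gm x z (circle_map (sval u)); lia.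
have pt (u : R) (w : T) : 0 <= u -> u < 2 -> circle_map u = w -> (d z w <= C)%N ->
    exists u : circle R, (d z (circle_map (sval u)) <= C)%N.
  by move=> u0 u2 <- zw; exists (exist _ u (introT andP (conj u0 u2))).
have DV : D%:R^-1 * D%:R = 1 :> R by rewrite mulVf // gt_eqF.
have on1 s : (s <= D)%N -> (d z (g s) <= C)%N ->
    exists u : circle R, (d z (circle_map (sval u)) <= C)%N.
  move=> sD zs; have s1 : s%:R / D%:R <= 1 :> R by rewrite ler_pdivrMr // mul1r ler_nat.
  apply: (pt (s%:R / D%:R) (g s)) => //.
    by apply: le_lt_trans s1 _; rewrite ltr1n.
  by rewrite /circle_map s1 divfK ?gt_eqF // natrK.
case: zon => [[s sD zE]|[t tL zE]]; first by apply: (on1 s) => //; rewrite zE gm_refl.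
(* The parameter of [h t] is [2 - t / D]. For [t = 0] it is 2, outside the circle, and for [t = D]
   it is 1, where [circle_map] follows [g]; [g 0] and [g D] serve instead. *)
case: (posnP t) => [t0|t_gt0].
  apply: (on1 0%N) => //; have := cl_upper cl (leq0n D) (leq0n L).
  by rewrite zE t0 (gm_sym gm); lia.
case: (ltnP t D) => [tD|Dt]; last first.
  have LD := cl_leD cl; apply: (on1 D) => //; have := cl_upper cl (leqnn D) tL.
  by rewrite zE (gm_sym gm); lia.
have t1 : t%:R / D%:R < 1 :> R by rewrite ltr_pdivrMr // mul1r ltr_nat.
have t2 : 0 < t%:R / D%:R :> R by rewrite divr_gt0 ?ltr0n.
apply: (pt (2 - t%:R / D%:R) (h t)); [lra|lra| |by rewrite zE gm_refl].
rewrite /circle_map ifF; last by apply/negbTE; rewrite -ltNge; lra.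
by rewrite opprB addrCA subrr addr0 divfK ?gt_eqF // natrK; congr h; lia.
Qed.

End CircleMap.

(** * Estimates for graphs and passage to the limit *)

Lemma GH_dist_coarse_loop (R : realType) (T : finType) (e : rel T) C g h L :
  geodesic_metric (gdist e) -> (0 < gdiam e)%N ->
  coarse_loop (gdist e) (gdiam e) C g h L ->
  GH_dist (@rescaled_dist R T e) (@circle_dist R) <= (4 * C + 4)%:R / (gdiam e)%:R.
Proof.
move=> gm D_gt0 cl; have D_gt0R : 0 < (gdiam e)%:R :> R by rewrite ltr0n.
(* Half of the distortion bound serves as [eps]; it also exceeds the density bound [2 * C]. *)
have -> : (4 * C + 4)%:R / (gdiam e)%:R = 2 * ((2 * C + 2)%:R / (gdiam e)%:R) :> R.
  by rewrite mulrA -natrM; congr (_%:R / _); lia.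
have y0 : circle R by exists 0; rewrite lexx ltr0n.
apply: (GH_dist_le (g := fun u => circle_map (gdiam e) g h L (sval u)) y0).
- exact: rescaled_pseudometric.
- exact: circle_dist_pseudometric.
- move=> u v; rewrite -(ler_pM2l D_gt0R) -{1}(gtr0_norm D_gt0R) -normrM mulrBr.
  rewrite /rescaled_dist mulrCA divff ?gt_eqF // mulr1.
  apply: le_trans (circle_map_distortion gm cl D_gt0 u v) _.
  rewrite mulrCA [_ * (_ / _)]mulrCA divff ?gt_eqF // mulr1 -natrM ler_nat; lia.
- move=> x; have [u ud] := circle_map_dense R gm cl D_gt0 x; exists u.
  by rewrite /rescaled_dist ler_pM2r ?invr_gt0 // ler_nat; lia.
Qed.

Lemma GH_dist_caret_free (R : realType) (T : finType) (e : rel T) (r : nat) :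
  simple_graph e -> connected_graph e -> vertex_transitive e ->
  (0 < r)%N -> ~ caret (gdist e) r -> (86 * r <= gdiam e)%N ->
  GH_dist (@rescaled_dist R T e) (@circle_dist R) <= (68 * r)%:R / (gdiam e)%:R.
Proof.
move=> [se _] ce vt r_gt0 nc rD; have D_gt0 : (0 < gdiam e)%N by lia.
have gm := gdist_geodesic se ce; have hom := gdist_homogeneous ce vt.
have [x0 _] : exists x0 : T, true.
  have [T0|/card_gt0P[x _]] := posnP #|T|; last by exists x.
  move: D_gt0; rewrite /gdiam big_pred0 // => x.
  by have := card0_eq T0 x; rewrite inE.
have [p [q pq]] := gdiam_attained e x0.
have [g [h [L cl]]] := coarse_loop_exists gm hom r_gt0 nc (gdist_le_gdiam e) pq rD.
apply: le_trans (GH_dist_coarse_loop R gm D_gt0 cl) _.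
(* With [C = 16 * r] and [r] positive, [4 * C + 4 <= 68 * r]. *)
by rewrite ler_pM2r ?invr_gt0 ?ltr0n // ler_nat; lia.
Qed.

(** Let [k] be least with [M < 3 ^ k]. Carets at all the scales [3 ^ j <= M] would give [4 ^ k]
    points, while [M] to the power log_3 4 is at most [4 ^ k]. *)
Lemma small_caret_free_scale (R : realType) (T : finType) (d : T -> T -> nat)
    (x0 : T) (M : R) :
  geodesic_metric d -> homogeneous d -> 0 <= M ->
  #|T|%:R < M `^ (ln 4 / ln 3) ->
  exists r : nat, [/\ (0 < r)%N, r%:R <= M & ~ caret d r].
Proof.
move=> gm hom M0 small.
have ex : exists k, M < (3 ^ k)%:R.
  exists (Num.trunc M).+1; apply: lt_le_trans (truncnS_gt M) _.
  by rewrite ler_nat; apply/ltnW/ltn_expl.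
have [k Mk min] := ex_minnP ex.
apply: contrapT => none.
have carets j : (j < k)%N -> caret d (3 ^ j).
  move=> jk; apply: contrapT => nc; apply: none; exists (3 ^ j)%N; split => //.
    by rewrite expn_gt0.
  by rewrite leNgt; apply/negP => /min; rewrite leqNgt jk.
have le := leq_trans (card_ball_carets gm hom carets x0) (max_card _).
have l3 : 0 < ln 3 :> R by apply: ln_gt0; rewrite ltr1n.
have l4 : 0 < ln 4 :> R by apply: ln_gt0; rewrite ltr1n.
have : M `^ (ln 4 / ln 3) <= (4 ^ k)%:R.
  have -> : (4 ^ k)%:R = (3 ^ k)%:R `^ (ln 4 / ln 3) :> R.
    rewrite !natrX -!powR_mulrn // powRAC; congr (_ `^ _).
    by rewrite -[LHS]lnK ?posrE ?ltr0n // -[RHS]lnK ?posrE ?powR_gt0 ?ltr0n // ln_powR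
      divfK // gt_eqF.
  by apply: ge0_ler_powR; rewrite ?nnegrE ?divr_ge0 // ltW.
by move=> /(lt_le_trans small); rewrite ltr_nat ltnNge le.
Qed.

(** For a = log_3 4 this is a + 1/a >= 2, that is, (a - 1)^2 >= 0. *)
Lemma critical_exponent_le (R : realType) : 2 - (ln 4 / ln 3)^-1 <= ln 4 / ln 3 :> R.
Proof.
have l3 : 0 < ln 3 :> R by apply: ln_gt0; rewrite ltr1n.
have l4 : 0 < ln 4 :> R by apply: ln_gt0; rewrite ltr1n.
have a0 : 0 < ln 4 / ln 3 :> R by rewrite divr_gt0.
rewrite lerBlDr -(ler_pM2r a0); set a := ln 4 / ln 3 in a0 *.
rewrite [leRHS]mulrDl mulVf ?gt_eqF // -subr_ge0.
have -> : a * a + 1 - 2 * a = (a - 1) ^+ 2 by rewrite expr2; lra.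
exact: sqr_ge0.
Qed.

Theorem theorem4 (R : realType) (T : nat -> finType) (e : forall n, rel (T n)) :
  (forall n, simple_graph (e n)) ->
  (forall n, connected_graph (e n)) ->
  (forall n, vertex_transitive (e n)) ->
  (forall M : nat, exists N : nat, forall n : nat, (N <= n)%N -> (M <= #|T n|)%N) ->
  ((fun n => (#|T n|%:R : R) / ((gdiam (e n))%:R `^ (2 - (ln 4 / ln 3)^-1)))
     @ \oo --> 0) ->
  (fun n => GH_dist (@rescaled_dist R (T n) (e n)) (@circle_dist R)) @ \oo --> 0.
Proof.
move=> simp conn vt large small; apply/cvgr0Pnorm_lt => eps eps_gt0.
pose a : R := ln 4 / ln 3.
(* A caret-free scale [r <= eta * D] then satisfies [86 * r <= D], and [68 * r / D] is strictly
   below [eps]. *)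
pose eta : R := Num.min 86^-1 (eps / 69).
have eta_gt0 : 0 < eta by rewrite lt_min invr_gt0 ltr0n divr_gt0.
have /cvgr0Pnorm_lt/(_ (eta `^ a) (powR_gt0 _ eta_gt0)) small_n := small.
have [N largeN] := large 2%N.
near=> n.
have card2 : (2 <= #|T n|)%N by apply: largeN; near: n; exact: nbhs_infty_ge.
have gm := gdist_geodesic (proj1 (simp n)) (conn n).
have hom := gdist_homogeneous (conn n) (vt n).
have /card_gt1P[x [y [_ _ xy]]] := card2.
have D_gt0 : (0 < gdiam (e n))%N.
  apply: leq_trans (gdist_le_gdiam (e n) x y); rewrite lt0n.
  by apply: contra_neq xy => /(gm_eq0 gm).
have D_gt0R : 0 < (gdiam (e n))%:R :> R by rewrite ltr0n.
have cardD : #|T n|%:R < (eta * (gdiam (e n))%:R) `^ a.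
  have : `|(#|T n|%:R : R) / ((gdiam (e n))%:R `^ (2 - a^-1))| < eta `^ a by near: n.
  rewrite ger0_norm ?divr_ge0 ?powR_ge0 // ltr_pdivrMr ?powR_gt0 // => lt.
  (* As the diameter is at least 1, raising its exponent to [a] only weakens the volume bound. *)
  apply: lt_le_trans lt _; rewrite powRM ?(ltW eta_gt0) // ler_pM2l ?powR_gt0 //.
  by apply: ler_powR; rewrite ?ler1n // critical_exponent_le.
have [r [r_gt0 rD nc]] := small_caret_free_scale x gm hom (mulr_ge0 (ltW eta_gt0) (ltW D_gt0R)) cardD.
have eta86 : eta <= 86^-1 by rewrite ge_min lexx.
have eta69 : eta <= eps / 69 by rewrite ge_min lexx orbT.
have r86 : (86 * r <= gdiam (e n))%N.
  rewrite -(ler_nat R) natrM -ler_pdivlMl ?ltr0n //.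
  by apply: le_trans rD _; rewrite ler_pM2r.
rewrite ger0_norm ?GH_dist_ge0 //.
apply: le_lt_trans (GH_dist_caret_free R (simp n) (conn n) (vt n) r_gt0 nc r86) _.
rewrite ltr_pdivrMr // natrM.
have : 68 * r%:R <= 68 * (eps / 69 * (gdiam (e n))%:R).
  by rewrite ler_pM2l // (le_trans rD) // ler_pM2r.
move=> /le_lt_trans; apply; rewrite !mulrA ltr_pM2r //; lra.
Unshelve. all: by end_near.
Qed.
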